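(* Let $f:\mathbb{R}^n\to\mathbb{R}$ be $C^2$ with a global minimizer $z^\star$, let $\varepsilon>0$, and let $z_0\in\mathbb{R}^n$ satisfy $z_0\notin\mathcal{T}_\varepsilon$ and $\nabla f(z_0)\neq0$. (a) Along any trajectory from $z_0$, a critical point is achievable as $z_K$ by a choice of the terminal coefficients $(c_{K-1,j})_{0\le j<K}$ if and only if the affine slice $z_0-S_K(z_0)$ meets the critical set $\operatorname{Crit}(f)$, so $$V_0(z_0)=\min\bigl\{K:\ (z_0-S_K(z_0))\cap\operatorname{Crit}(f)\neq\emptyset\ \text{for some trajectory}\bigr\},$$ with $V_0(z_0)=\infty$ if no such $K$ exists. (b) If no slice reachable from $z_0$ is $\nabla^2 f$-invariant while disjoint from the critical set, then $V_0(z_0)\le n$. Conversely, $V_0(z_0)=\infty$ if and only if every trajectory from $z_0$ freezes at an invariant slice that contains no critical point.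
   Context: Trajectories: a trajectory from $z_0$ is a sequence with $z_{k+1}=z_0-\sum_{j=0}^{k}c_{k,j}\,g_j$, where $g_j=\nabla f(z_j)$ and the coefficients $c_{k,j}\in\mathbb{R}$ are arbitrary. Along a trajectory, for $K\ge1$, $S_K(z_0)=\operatorname{span}\{g_0,\dots,g_{K-1}\}$ (it depends on $z_0,\dots,z_{K-1}$), and $A_K=z_0-S_K(z_0)=\{z_0-s:\ s\in S_K(z_0)\}$ is the affine slice. A slice reachable from $z_0$ is a set $A_K$ arising from some trajectory from $z_0$ and some $K\ge1$. Targets: $\mathcal{T}_\varepsilon=\{z:\|\nabla f(z)\|\le\varepsilon\}$ and $\operatorname{Crit}(f)=\{z:\nabla f(z)=0\}$. Exact-reaching value: $V_0(z_0)$ is the least $K\in\{0,1,2,\dots\}$ for which some trajectory $z_0,\dots,z_K$ has $\nabla f(z_K)=0$, and $V_0(z_0)=\infty$ if there is none. Invariance: the slice $A_K=z_0-S_K(z_0)$ is $\nabla^2 f$-invariant (invariant, for short) if, with $P_K$ the orthogonal projection onto $S_K(z_0)^\perp$, $P_K\nabla^2 f(z)v=0$ for all $z\in A_K$ and all $v\in S_K(z_0)$. Freezing: a trajectory freezes at an invariant slice $A_K$ when its slice at stage $K$ is the invariant slice $A_K$; from then on every continuation keeps $z_k\in A_K$ and $g_k\in S_K(z_0)$, so the span never grows again.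
   Formalization: In the last claim of (b), ''every trajectory'' is restricted to those that do not stall (span stops growing while the slice still has a point with gradient outside it); stalling ones, e.g. all coefficients zero, can never freeze, so the literal ''only if'' fails. *)

(* Defs.v *)
From HB Require Import structures.
From mathcomp Require Import all_boot all_order all_algebra.
From mathcomp Require Import all_classical all_reals all_analysis.

Set Implicit Arguments.
Unset Strict Implicit.
Unset Printing Implicit Defensive.

Import Order.TTheory GRing.Theory Num.Theory.
Import numFieldNormedType.Exports.

Local Open Scope classical_set_scope.
Local Open Scope ring_scope.

(* Points of R^n, and gradients, are row vectors: a linear map acts on them
   by multiplication on the right, and a linear subspace is represented by a
   matrix whose row space it is (scope %MS). *)

Definition grad (R : realType) (n : nat) (f : 'rV[R]_n -> R) (z : 'rV[R]_n) :
    'rV[R]_n :=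
  \row_(i < n) 'D_(delta_mx 0 i) f z.

(* v *m hessian f z is the derivative of grad f at z in the direction v. *)
Definition hessian (R : realType) (n : nat) (f : 'rV[R]_n -> R)
    (z : 'rV[R]_n) : 'M[R]_n :=
  'J (grad f) z.

Definition C2 (R : realType) (n : nat) (f : 'rV[R]_n -> R) : Prop :=
  [/\ forall z, differentiable f z,
      forall z, differentiable (grad f) z
    & continuous (hessian f)].

(* The library norm `|_| on 'rV[R]_n is the sup norm. *)
Definition enorm (R : realType) (n : nat) (v : 'rV[R]_n) : R :=
  Num.sqrt (\sum_(i < n) v 0 i ^+ 2).

Definition target (R : realType) (n : nat) (f : 'rV[R]_n -> R) (eps : R) :
    set 'rV[R]_n :=
  [set z | enorm (grad f z) <= eps].

Definition crit (R : realType) (n : nat) (f : 'rV[R]_n -> R) :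
    set 'rV[R]_n :=
  [set z | grad f z = 0].

(* The point z_K obtained from z_0, ..., z_{K-1} with the coefficients
   c_{K-1,j} = a j. *)
Definition next_point (R : realType) (n : nat) (f : 'rV[R]_n -> R)
    (z : nat -> 'rV[R]_n) (K : nat) (a : nat -> R) : 'rV[R]_n :=
  z 0%N - \sum_(j < K) a j *: grad f (z j).

(* Trajectories are infinite; a finite one z_0, ..., z_K extends to an
   infinite one, for instance with all further coefficients zero. *)
Definition trajectory (R : realType) (n : nat) (f : 'rV[R]_n -> R)
    (z0 : 'rV[R]_n) (z : nat -> 'rV[R]_n) : Prop :=
  z 0%N = z0 /\
  exists c : nat -> nat -> R, forall k, z k.+1 = next_point f z k.+1 (c k).

Definition gspan (R : realType) (n : nat) (f : 'rV[R]_n -> R)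
    (z : nat -> 'rV[R]_n) (K : nat) : 'M[R]_(K, n) :=
  \matrix_(j < K) grad f (z j).

Definition slice (R : realType) (n K : nat) (z0 : 'rV[R]_n)
    (S : 'M[R]_(K, n)) : set 'rV[R]_n :=
  [set z0 - s | s in [set s : 'rV[R]_n | (s <= S)%MS]].

(* The orthogonal projection onto the orthogonal complement of the row space
   of S, which is kermx S^T = {u | u *m S^T = 0}. *)
Definition proj_perp (R : realType) (n K : nat) (S : 'M[R]_(K, n)) :
    'M[R]_n :=
  proj_mx (kermx S^T) <<S>>%MS.

Definition invariant_slice (R : realType) (n K : nat) (f : 'rV[R]_n -> R)
    (z0 : 'rV[R]_n) (S : 'M[R]_(K, n)) : Prop :=
  forall z v : 'rV[R]_n, slice z0 S z -> (v <= S)%MS ->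
    (v *m hessian f z) *m proj_perp S = 0.

Definition freezes_at (R : realType) (n : nat) (f : 'rV[R]_n -> R)
    (z : nat -> 'rV[R]_n) (K : nat) : Prop :=
  (0 < K)%N /\ invariant_slice f (z 0%N) (gspan f z K).

(* The span stops growing for good although its slice still contains a point
   whose gradient would enlarge it (e.g. z_k = z_0 for all k, when the line
   through z_0 directed by grad f z_0 contains such a point). On an invariant
   slice all gradients lie in the span, so such a trajectory freezes nowhere;
   every other trajectory does freeze. *)
Definition stalls (R : realType) (n : nat) (f : 'rV[R]_n -> R)
    (z : nat -> 'rV[R]_n) : Prop :=
  exists K, [/\ (0 < K)%N,
    forall M, (K <= M)%N -> (gspan f z M == gspan f z K)%MS
    & exists2 w, slice (z 0%N) (gspan f z K) w
               & ~~ (grad f w <= gspan f z K)%MS].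

(* None stands for the value infinity. *)
Definition least (P : set nat) : option nat :=
  if pselect (exists k, `[< P k >]) is left exP then Some (ex_minn exP)
  else None.

Definition V0 (R : realType) (n : nat) (f : 'rV[R]_n -> R) (z0 : 'rV[R]_n) :
    option nat :=
  least [set K | exists2 z, trajectory f z0 z & crit f (z K)].

(* Main.v *)
(* At an invariant slice through z0 the component of grad f orthogonal to the
   span has zero derivative along every segment of the slice and vanishes at z0,
   so all gradients on the slice lie in the span; conversely this forces
   invariance.  Hence on a non-invariant slice one can choose the next point so
   that the span grows, and once the span is R^n the slice contains zstar.  If
   some trajectory reaches a critical point z_K, then continuing it from there
   by such choices gives a trajectory that does not stall, and any invariant
   slice at which it freezes contains all its points, z_K included. *)

Require Import Defs.
From HB Require Import structures.
From mathcomp Require Import all_boot all_order all_algebra.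
From mathcomp Require Import all_classical all_reals all_analysis.

Import Order.TTheory GRing.Theory Num.Theory.
Import numFieldNormedType.Exports.

Local Open Scope classical_set_scope.
Local Open Scope ring_scope.

(** * Derivatives along lines and first-order optimality *)

Lemma is_derive_line (R : realType) (V W : normedModType R) (F : V -> W)
    (x v : V) (t : R) :
  differentiable F (x + t *: v) ->
  is_derive t 1 (fun s : R => F (x + s *: v)) ('D_v F (x + t *: v)).
Proof.
move=> dF.
have E : (fun h : R => h^-1 *: (((fun s => F (x + s *: v)) \o shift t) (h *: 1)
             - F (x + t *: v))) =
         (fun h : R => h^-1 *: ((F \o shift (x + t *: v)) (h *: v)
             - F (x + t *: v))).
  apply/funext => h /=.
  by rewrite [h *: 1]mulr1 scalerDl addrCA.
split; last by rewrite /derive E.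
rewrite /derivable E.
exact: diff_derivable dF.
Qed.

Lemma grad_at_min (R : realType) (n : nat) (f : 'rV[R]_n -> R) (x : 'rV[R]_n) :
  (forall z, differentiable f z) -> (forall z, f x <= f z) -> grad f x = 0.
Proof.
move=> df xmin; apply/rowP => i; rewrite !mxE.
set v : 'rV[R]_n := delta_mx 0 i.
have x0 : x + 0 *: v = x by rewrite scale0r addr0.
have := @is_derive_line _ _ _ f x v 0 (df _).
rewrite x0 => -[_ <-].
(* The bounds -1 and 1 are arbitrary: any open interval around 0 serves. *)
have [//|t _|//||_ ->//] :=
  @derive1_at_min R (fun s : R => f (x + s *: v)) (-1) 1 0.
- by have [] := @is_derive_line _ _ _ f x v t (df _).
- by rewrite in_itv /= ltrN10 ltr01.
- by move=> t _; rewrite x0.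
Qed.

(** * Orthogonal complements and affine slices *)

Section LinearAlgebra.
Context {R : realType} {n : nat}.

Lemma rV_dot_eq0 (u : 'rV[R]_n) : u *m u^T = 0 -> u = 0.
Proof.
move=> /matrixP /(_ 0 0); rewrite !mxE => /eqP.
rewrite psumr_eq0; last by move=> i _; rewrite mxE -expr2 sqr_ge0.
move=> /allP u0; apply/rowP => i; rewrite mxE.
have := u0 i (mem_index_enum _).
by rewrite !mxE -expr2 sqrf_eq0 => /eqP.
Qed.

Context {K : nat}.
Implicit Type S : 'M[R]_(K, n).

(** If $u = DS$ and $uS^T = 0$, then $uu^T = uS^TD^T = 0$, which over the reals forces $u = 0$. *)
Lemma capmx_perp S : (kermx S^T :&: <<S>> = 0)%MS.
Proof.
apply/eqP/rowV0P => u; rewrite sub_capmx genmxE => /andP[/sub_kermxP uS].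
move=> /submxP[D uE]; apply: rV_dot_eq0.
by rewrite {2}uE trmx_mul mulmxA uS mul0mx.
Qed.

Lemma addsmx_perp S : ((kermx S^T + <<S>>)%MS :=: 1%:M)%MS.
Proof.
apply/eqmxP; rewrite submx1 /= sub1mx /row_full.
have := mxrank_sum_cap (kermx S^T) <<S>>%MS.
rewrite capmx_perp mxrank0 addn0 => ->.
by rewrite mxrank_ker genmxE mxrank_tr subnK // rank_leq_col.
Qed.

(** Since [kermx S^T] and [S] are complementary, the kernel of the projection is exactly the row
    space of [S]. This turns membership in the span into an equation that can be differentiated. *)
Lemma mulmx_proj_perp_eq0 (m : nat) (W : 'M[R]_(m, n)) S :
  W *m proj_perp S = 0 <-> (W <= S)%MS.
Proof.
split=> [WP|WS]; last by rewrite proj_mx_0 ?capmx_perp ?genmxE.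
have : (W - W *m proj_perp S <= <<S>>)%MS.
  by rewrite proj_mx_compl_sub // addsmx_perp submx1.
by rewrite WP subr0 genmxE.
Qed.

Lemma sliceE (z0 p : 'rV[R]_n) S : slice z0 S p <-> (z0 - p <= S)%MS.
Proof.
split=> [[s /= sS <-]|pS]; first by rewrite opprB addrC subrK.
by exists (z0 - p) => //; rewrite opprB addrC subrK.
Qed.

Lemma slice_start (z0 : 'rV[R]_n) S : slice z0 S z0.
Proof. by apply/sliceE; rewrite subrr sub0mx. Qed.

Lemma slice_line (z0 p v : 'rV[R]_n) S (t : R) :
  slice z0 S p -> (v <= S)%MS -> slice z0 S (p + t *: v).
Proof.
move=> /sliceE pS vS; apply/sliceE.
by rewrite opprD addrA addmx_sub // eqmx_opp scalemx_sub.
Qed.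

End LinearAlgebra.

Lemma slice_subset (R : realType) (n K L : nat) (z0 p : 'rV[R]_n)
    (S : 'M[R]_(K, n)) (T : 'M[R]_(L, n)) :
  (S <= T)%MS -> slice z0 S p -> slice z0 T p.
Proof. by move=> ST /sliceE pS; apply/sliceE; apply: submx_trans pS ST. Qed.

(** * Invariance of a slice and gradients on it *)

Lemma is_derive_mulmx_line (R : realType) (n m : nat)
    (G : 'rV[R]_n -> 'rV[R]_n) (x v : 'rV[R]_n) (P : 'M[R]_(n, m)) (j : 'I_m)
    (t : R) :
  (forall z, differentiable G z) ->
  is_derive t 1 (fun s : R => (G (x + s *: v) *m P) 0 j)
    ((v *m 'J G (x + t *: v) *m P) 0 j).
Proof.
move=> dG.
have [dl Dl] := is_derive_line _ _ _ _ _ _ _ (dG (x + t *: v)).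
have -> : (fun s : R => (G (x + s *: v) *m P) 0 j) =
    \sum_(k < n) (fun s : R => P k j *: G (x + s *: v) 0 k).
  apply/funext => s; rewrite fct_sumE mxE; apply: eq_bigr => k _.
  by rewrite mulrC.
have -> : (v *m 'J G (x + t *: v) *m P) 0 j =
    \sum_(k < n) P k j *: ((v *m 'J G (x + t *: v)) 0 k).
  by rewrite mxE; apply: eq_bigr => k _; rewrite mulrC.
apply: is_derive_sum => k; apply: is_deriveZ.
split; first by move/derivable_mxP: dl; apply.
by rewrite -deriveEjacobian // -Dl derive_mx // mxE.
Qed.

Section Invariance.
Context {R : realType} {n K : nat} (f : 'rV[R]_n -> R).
Hypothesis dgrad : forall z, differentiable (grad f) z.
Context (z0 : 'rV[R]_n) (S : 'M[R]_(K, n)).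

Lemma invariant_slice_grad_sub :
  invariant_slice f z0 S -> (grad f z0 <= S)%MS ->
  forall w, slice z0 S w -> (grad f w <= S)%MS.
Proof.
move=> inv g0 w wS; apply/mulmx_proj_perp_eq0/rowP => j.
have vS : (w - z0 <= S)%MS by rewrite -opprB eqmx_opp; apply/sliceE.
pose h (s : R) := (grad f (z0 + s *: (w - z0)) *m proj_perp S) 0 j.
(* The line through [z0] and [w] stays in the slice, so invariance kills the derivative of [h] at
   every [t]; then $h(1) = h(0) = 0$. *)
have dh (t : R) : is_derive t 1 h 0.
  have := is_derive_mulmx_line _ _ _ _ z0 (w - z0) (proj_perp S) j t dgrad.
  rewrite [_ *m 'J _ _ *m _]inv ?mxE //.
  by apply: slice_line => //; apply: slice_start.
have := @is_derive_0_is_cst R h 1 0 dh.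
rewrite /h scale1r scale0r addr0 addrCA subrr addr0 => ->.
by rewrite (mulmx_proj_perp_eq0 _ _ _).2.
Qed.

Lemma grad_sub_invariant_slice :
  (forall w, slice z0 S w -> (grad f w <= S)%MS) -> invariant_slice f z0 S.
Proof.
move=> gS z v zS vS; apply/rowP => j.
have := is_derive_mulmx_line _ _ _ _ z v (proj_perp S) j 0 dgrad.
rewrite scale0r addr0 => -[_ <-].
have -> : (fun s : R => (grad f (z + s *: v) *m proj_perp S) 0 j) = cst 0.
  apply/funext => s; rewrite (mulmx_proj_perp_eq0 _ _ _).2 ?mxE //.
  exact/gS/slice_line.
by rewrite derive_cst mxE.
Qed.

End Invariance.

(** * Least elements and course-of-values recursion *)

Lemma leastP (P : set nat) k :
  P k -> exists2 m, least P = Some m & (P m /\ (m <= k)%N).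
Proof.
move=> Pk; rewrite /least; case: pselect => [exP|[]]; last first.
  by exists k; apply/asboolP.
case: ex_minnP => m /asboolP Pm mmin; exists m => //; split=> //.
exact/mmin/asboolP.
Qed.

Lemma least_None (P : set nat) : least P = None -> forall k, ~ P k.
Proof. by move=> P0 k /leastP[m]; rewrite P0. Qed.

Lemma strong_recursion (T : pointedType) (step : (nat -> T) -> nat -> T) :
  (forall k w w', (forall i, (i < k)%N -> w i = w' i) -> step w k = step w' k) ->
  exists z, forall k, z k = step z k.
Proof.
move=> step_ext.
(* [hist k] lists the first [k] values; reading past its end gives [point], which [step] at [k]
   ignores by [step_ext]. *)
pose fix hist k : seq T :=
  if k is k'.+1 then rcons (hist k') (step (nth point (hist k')) k') else [::].
have size_hist k : size (hist k) = k by elim: k => //= k IH; rewrite size_rcons IH.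
have hist_nth k i : (i < k)%N ->
    nth point (hist k) i = nth point (hist i.+1) i.
  elim: k => // k IH; rewrite ltnS leq_eqVlt => /predU1P[->//|ik].
  by rewrite -IH //= nth_rcons size_hist ik.
exists (fun k => nth point (hist k.+1) k) => k.
rewrite /= nth_rcons size_hist ltnn eqxx.
by apply: step_ext => i; apply: hist_nth.
Qed.

(** * Trajectories and the growth of their spans *)

Section Trajectories.
Context {R : realType} {n : nat} (f : 'rV[R]_n -> R).
Implicit Types z w : nat -> 'rV[R]_n.

Lemma slice_next_point z K p :
  slice (z 0%N) (gspan f z K) p <-> exists a, p = next_point f z K a.
Proof.
rewrite /next_point; split=> [/sliceE/submxP[D DE]|[a ->]].
  (* Only the coefficients with index below [K] matter; the others are set to 0. *)
  exists (fun j => if insub j is Some i then D 0 i else 0).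
  apply: (canRL (subKr _)); rewrite DE mulmx_sum_row.
  by apply: eq_bigr => j _; rewrite valK rowK.
apply/sliceE; rewrite subKr summx_sub // => j _; apply: scalemx_sub.
by have := row_sub j (gspan f z K); rewrite rowK.
Qed.

(** This eliminates the coefficients, so that trajectories can be built by choosing points in
    slices. *)
Lemma trajectoryE (z0 : 'rV[R]_n) z :
  trajectory f z0 z <->
  z 0%N = z0 /\ forall k, (0 < k)%N -> slice z0 (gspan f z k) (z k).
Proof.
split=> [[<- [c zE]]|[<- zE]]; split=> //.
  by case=> // k _; apply/slice_next_point; exists (c k).
have [k|c zc] := @choice _ _ (fun k a => z k.+1 = next_point f z k.+1 a).
  exact/slice_next_point/zE.
by exists c.
Qed.

Lemma gspan_subP m (B : 'M[R]_(m, n)) z K :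
  (gspan f z K <= B)%MS <-> forall j, (j < K)%N -> (grad f (z j) <= B)%MS.
Proof.
split=> [zB j jK|zB].
  by have /row_subP/(_ (Ordinal jK)) := zB; rewrite rowK.
by apply/row_subP => j; rewrite rowK; apply: zB.
Qed.

Lemma grad_sub_gspan z K j : (j < K)%N -> (grad f (z j) <= gspan f z K)%MS.
Proof. exact: (gspan_subP _ _ _ _).1 j. Qed.

Lemma gspanS z K L : (K <= L)%N -> (gspan f z K <= gspan f z L)%MS.
Proof. by move=> KL; apply/gspan_subP => j jK; exact/grad_sub_gspan/(leq_trans jK). Qed.

Lemma eq_gspan z w K :
  (forall j, (j < K)%N -> z j = w j) -> gspan f z K = gspan f w K.
Proof. by move=> zw; apply/row_matrixP => j; rewrite !rowK zw. Qed.

(** Keep the first [K] points and stay at [p] forever: spans only grow, so [p] lies in all later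
    slices. *)
Lemma trajectory_redirect (z0 : 'rV[R]_n) z K p :
  trajectory f z0 z -> (0 < K)%N -> slice z0 (gspan f z K) p ->
  exists2 w, trajectory f z0 w & w K = p.
Proof.
move=> /trajectoryE[z00 zS] K0 pS.
pose w k := if (k < K)%N then z k else p.
have wz L : (L <= K)%N -> gspan f w L = gspan f z L.
  by move=> LK; apply: eq_gspan => j jL; rewrite /w (leq_trans jL LK).
exists w; last by rewrite /w ltnn.
apply/trajectoryE; split=> [|k k0]; first by rewrite /w K0.
have [kK|Kk] := ltnP k K; first by rewrite (wz _ (ltnW kK)) /w kK; apply: zS.
have -> : w k = p by rewrite /w ltnNge Kk.
by apply: (slice_subset _ _ _ _ _ _ _ _ (gspanS w _ _ Kk)); rewrite wz.
Qed.

(** From stage [N] on, pick a point of the slice whose gradient leaves the span if there is one, and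
    otherwise [z0], which lies in every slice. *)
Lemma trajectory_greedy (z0 : 'rV[R]_n) z N :
  trajectory f z0 z -> (0 < N)%N ->
  exists w, [/\ trajectory f z0 w, forall k, (k < N)%N -> w k = z k &
    forall k, (N <= k)%N ->
      (exists2 p, slice z0 (gspan f w k) p & ~~ (grad f p <= gspan f w k)%MS) ->
      ~~ (grad f (w k) <= gspan f w k)%MS].
Proof.
move=> /trajectoryE[z00 zS] N0.
pose fresh w k :=
  [set p | slice z0 (gspan f w k) p /\ ~~ (grad f p <= gspan f w k)%MS].
pose step w k := if (k < N)%N then z k else xget z0 (fresh w k).
have [k w w' ww'|w wE] := @strong_recursion _ step.
  by rewrite /step /fresh (eq_gspan _ _ _ ww').
have wz k : (k < N)%N -> w k = z k by move=> kN; rewrite wE /step kN.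
exists w; split=> //.
- apply/trajectoryE; split=> [|k k0]; first by rewrite wz.
  have [kN|Nk] := ltnP k N.
    rewrite wz // (@eq_gspan w z k); first exact: zS.
    by move=> j jk; rewrite wz // (ltn_trans jk).
  rewrite wE /step ltnNge Nk /=.
  by case: xgetP => [p _ []//|_]; apply: slice_start.
- move=> k Nk [p pS pg]; rewrite wE /step ltnNge Nk /=.
  have [] // : fresh w k (xget z0 (fresh w k)).
  exact: (@xgetI _ z0 (fresh w k) p).
Qed.

(** Ranks are at most [n]; take a stage of maximal rank. Later spans contain its span and have the
    same rank. *)
Lemma gspan_stabilizes z :
  exists2 K, (0 < K)%N &
    forall M, (K <= M)%N -> (gspan f z M == gspan f z K)%MS.
Proof.
pose P r := `[< exists2 K, (0 < K)%N & \rank (gspan f z K) = r >].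
have exP : exists r, P r.
  by exists (\rank (gspan f z 1)); apply/asboolP; exists 1%N.
have leP r : P r -> (r <= n)%N by move=> /asboolP[K _ <-]; apply: rank_leq_col.
have [r /asboolP[K K0 rK] rmax] := ex_maxnP exP leP.
exists K => // M KM; rewrite andbC.
have /mxrank_leqif_eq[_ <-] := gspanS z _ _ KM.
rewrite eqn_leq mxrankS ?gspanS // rK; apply: rmax; apply/asboolP; exists M => //.
exact: leq_trans KM.
Qed.

Lemma rank_gspan_fresh z K :
  ~~ (grad f (z K) <= gspan f z K)%MS ->
  (\rank (gspan f z K) < \rank (gspan f z K.+1))%N.
Proof.
move=> gK; apply: rank_ltmx; rewrite /ltmx gspanS //=.
by apply: contra gK => /(gspan_subP _ _ _ _) -> //.
Qed.

Hypothesis dgrad : forall p, differentiable (grad f) p.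

(** By strong induction: points so far in the slice have their gradients in its span, so the next
    slice is contained in this one. *)
Lemma freezes_at_slice (z0 : 'rV[R]_n) z K :
  trajectory f z0 z -> freezes_at f z K ->
  forall M, slice z0 (gspan f z K) (z M).
Proof.
move=> /trajectoryE[<- zS] [K0 inv].
have gS := @invariant_slice_grad_sub _ _ _ _ dgrad _ _ inv (grad_sub_gspan _ _ _ K0).
move=> M; elim/ltn_ind: M => -[_|M IH]; first exact: slice_start.
apply: (slice_subset _ _ _ _ _ _ _ _ _ (zS M.+1 isT)).
by apply/gspan_subP => j jM; apply/gS/IH.
Qed.

End Trajectories.

(** * Reachability of critical points *)

Theorem theorem2 (R : realType) (n : nat) (f : 'rV[R]_n -> R)
  (zstar z0 : 'rV[R]_n) (eps : R)
  (f_C2 : C2 f)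
  (zstar_min : forall z, f zstar <= f z)
  (eps_gt0 : 0 < eps)
  (z0_notin_target : ~ target f eps z0)
  (grad_z0_neq0 : grad f z0 <> 0) :
  ((forall z, trajectory f z0 z -> forall K, (0 < K)%N ->
      ((exists a : nat -> R, crit f (next_point f z K a)) <->
       slice z0 (gspan f z K) `&` crit f !=set0))
   /\
   V0 f z0 = least [set K | (0 < K)%N /\
     exists2 z, trajectory f z0 z &
                slice z0 (gspan f z K) `&` crit f !=set0])
  /\
  (((forall z K, trajectory f z0 z -> (0 < K)%N ->
       ~ (invariant_slice f z0 (gspan f z K) /\
          slice z0 (gspan f z K) `&` crit f = set0)) ->
    exists2 K, V0 f z0 = Some K & (K <= n)%N)
   /\
   (V0 f z0 = None <->
    forall z, trajectory f z0 z -> ~ stalls f z ->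
      exists K, freezes_at f z K /\
                slice z0 (gspan f z K) `&` crit f = set0)).
Proof.
have [df dgrad _] := f_C2.
have crit_zstar : crit f zstar by apply: grad_at_min.
have reach z : trajectory f z0 z -> forall K, (0 < K)%N ->
    (exists a, crit f (next_point f z K a)) <->
    slice z0 (gspan f z K) `&` crit f !=set0.
  move=> [<- _] K _; split=> [[a ca]|[p [/slice_next_point[a ->] ca]]].
    by exists (next_point f z K a); split=> //; apply/slice_next_point; exists a.
  by exists a.
have V0E : V0 f z0 = least [set K | (0 < K)%N /\
    exists2 z, trajectory f z0 z & slice z0 (gspan f z K) `&` crit f !=set0].
  rewrite /V0; congr least; apply/seteqP; split=> K /=.
    move=> [z zt zK]; have [z00 zS] := (trajectoryE _ _ _).1 zt.
    have K0 : (0 < K)%N.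
      (* Stage 0 is excluded because [z0] is not critical. *)
      by case: K zK => // zK; case: grad_z0_neq0; rewrite -z00.
    by split=> //; exists z => //; exists (z K); split=> //; apply: zS.
  move=> [K0 [z zt [p [pS pc]]]].
  by have [w wt wK] := trajectory_redirect _ _ _ _ _ zt K0 pS; exists w; rewrite ?wK.
split; first by split.
split.
- move=> no_trap.
  have zc : trajectory f z0 (fun=> z0).
    by apply/trajectoryE; split=> // k _; apply: slice_start.
  (* With [N = 1] only the starting point is prescribed; every later choice is greedy. *)
  have [z [zt z1 zfresh]] := trajectory_greedy _ _ _ 1 zc isT.
  have [[K [Kn K0 Kmeet]]|nomeet] := pselect (exists K, [/\ (K <= n)%N, (0 < K)%N &
      slice z0 (gspan f z K) `&` crit f !=set0]).
    rewrite V0E.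
    have [|L -> [_ LK]] := @leastP [set K | (0 < K)%N /\
      exists2 z, trajectory f z0 z & slice z0 (gspan f z K) `&` crit f !=set0] K.
      by split=> //; exists z.
    by exists L => //; apply: leq_trans Kn.
  (* While no slice up to stage [n] meets the critical set, each step raises the rank: otherwise all
     gradients on the slice lie in the span, and it is an invariant slice forbidden by [no_trap]. *)
  have rankK K : (0 < K)%N -> (K <= n)%N -> (K <= \rank (gspan f z K))%N.
    elim: K => // -[_ _ _|K IH _ Kn].
      rewrite lt0n mxrank_eq0; apply/eqP => /row_matrixP/(_ ord0).
      by rewrite rowK row0 z1.
    apply: leq_ltn_trans (IH isT (ltnW Kn)) _; apply: rank_gspan_fresh.
    apply: zfresh => //; apply: contrapT => nofresh.
    apply: (no_trap z K.+1 zt isT); split.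
      apply: grad_sub_invariant_slice => // p pS; apply: contrapT => /negP pg.
      by apply: nofresh; exists p.
    by apply: contrapT => /eqP/set0P meet; apply: nomeet; exists K.+1; rewrite (ltnW Kn).
  have n0 : (0 < n)%N.
    rewrite lt0n; apply/eqP => n0; apply: grad_z0_neq0; apply/rowP.
    by case=> i lt_in; exfalso; rewrite n0 in lt_in.
  (* At rank [n] the slice is the whole space and contains [zstar]. *)
  case: nomeet; exists n; split=> //; exists zstar; split=> //.
  apply/sliceE; apply: submx_full; rewrite /row_full eqn_leq rank_leq_col.
  exact: rankK.
split=> [V0None z zt nstall|all_freeze].
- have [K K0 Kstab] := gspan_stabilizes f z.
  have z00 : z 0%N = z0 by case: zt.
  exists K; split.
    split=> //; rewrite z00.
    apply: grad_sub_invariant_slice => // p pS; apply: contrapT => /negP pg.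
    by apply: nstall; exists K; split=> //; rewrite z00; exists p.
  apply: contrapT => /eqP/set0P meet; rewrite V0E in V0None.
  by apply: (least_None _ V0None K); split=> //; exists z.
apply: contrapT => V0Some.
have [K [z zt zK]] : exists K, exists2 z, trajectory f z0 z & crit f (z K).
  apply: contrapT => none; apply: V0Some; rewrite /V0 /least.
  by case: pselect => // -[k Pk]; case: none; exists k; move/asboolP: Pk.
(* [N = K.+1] keeps the critical point [z K] on the new trajectory. *)
have [w [wt wz wfresh]] := trajectory_greedy _ _ _ K.+1 zt isT.
have w00 : w 0%N = z0 by case: wt.
have [|L [Lfr Ldisj]] := all_freeze w wt.
  move=> [L [_ Lstab [p]]]; rewrite w00 => pS pg.
  (* At stage [M] the span has stopped growing and the choices are already greedy, so [w M] would
     have a gradient outside the span, yet that gradient lies in the equal span at [M.+1]. *)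
  set M := maxn L K.+1.
  have LM : (L <= M)%N by apply: leq_maxl.
  have /negP[] : ~~ (grad f (w M) <= gspan f w M)%MS.
    apply: wfresh; first exact: leq_maxr.
    exists p; first exact: (slice_subset _ _ _ _ _ _ _ _ (gspanS f w _ _ LM) pS).
    by apply: contra pg => /submx_trans -> //; have /andP[] := Lstab _ LM.
  apply: submx_trans (grad_sub_gspan f w M.+1 M (ltnSn _)) _.
  have /andP[h _] := Lstab _ (leqW LM).
  by apply: submx_trans h _; apply: gspanS.
suff : (slice z0 (gspan f w L) `&` crit f) (w K) by rewrite Ldisj.
split; last by rewrite wz.
exact: (freezes_at_slice f dgrad z0 w L wt Lfr K).
Qed.
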